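(* Let $(d_1,\dots,d_r)\in\mathbb{N}^r$ with $1\le d_i\le q$ for every $i\in\{1,\dots,r\}$, where $r\le n$. For each $i$ let $a_{i,1},\dots,a_{i,d_i}$ be pairwise distinct elements of $\mathbb{F}_q$, and let $X\subset\mathbb{P}^n$ be the tubular set defined by the family $(a_{i,j})$. Then $X$ is an ideal-theoretic complete intersection, defined over $\mathbb{F}_q$, of dimension $m=n-r$, multidegree $(d_1,\dots,d_r)$, and degree $d=d_1\cdots d_r\le q^r$. Moreover: (i) The affine algebraic subset $X'=X\cap\mathbb{A}^n$ satisfies $$|X'(\mathbb{F}_q)|=d\,q^m .$$ (ii) The projective algebraic subset $X$ satisfies $$|X(\mathbb{F}_q)|=d\,q^m+\pi_{m-1}=d\,\pi_m-(d-1)\,\pi_{m-1}.$$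
   Context: $K=\overline{\mathbb{F}}_q$, $\mathbb{P}^n=\mathbb{P}^n(K)$ with homogeneous coordinates $T_0,\dots,T_n$, and $\mathbb{A}^n=\mathbb{P}^n\setminus\{T_0=0\}$. Let $D=\prod_{i=1}^r\{1,\dots,d_i\}$. For $J=(j(1),\dots,j(r))\in D$ let $Y_J\subset\mathbb{P}^n$ be the linear variety defined by $T_i-a_{i,j(i)}T_0=0$ for $1\le i\le r$. The tubular set defined by $(a_{i,j})$ is $X=\bigcup_{J\in D}Y_J$. An algebraic subset of $\mathbb{P}^n$ of dimension $n-r$ is an ideal-theoretic complete intersection if its ideal (the radical ideal of polynomials in $K[T_0,\dots,T_n]$ vanishing on it) can be generated by $r$ homogeneous polynomials; the family of their degrees, which depends only on the set, is its multidegree. The degree is the usual degree: the number of points of $X\cap L$ for almost all linear varieties $L$ of dimension $n-\dim X$. $X(\mathbb{F}_q)$ and $X'(\mathbb{F}_q)$ denote the sets of points with coordinates in $\mathbb{F}_q$. For $l\ge0$, $\pi_l=|\mathbb{P}^l(\mathbb{F}_q)|=q^l+\dots+q+1$, and $\pi_{-1}=0$. *)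

(* Defs.v *)
From HB Require Import structures.
From mathcomp Require Import all_boot all_order all_algebra all_field.
From mathcomp Require Import boolp classical_sets functions cardinality.
From mathcomp Require Import mpoly.

Set Implicit Arguments.
Unset Strict Implicit.
Unset Printing Implicit Defensive.

Import GRing.Theory.
Local Open Scope classical_set_scope.
Local Open Scope ring_scope.

(* P^n(K): the lines through the origin in K^(n+1). *)
Definition proj (K : fieldType) (n : nat) : Type :=
  {L : {vspace 'rV[K]_n.+1} | \dim L == 1%N}.

Section ProjectiveSets.
Variables (K : fieldType) (n : nat).
Implicit Types (X Z A B : set (proj K n)) (P : proj K n).

Definition hcoord P (v : 'rV[K]_n.+1) : Prop := v != 0 /\ v \in val P.

(* f is not assumed homogeneous, hence the quantification over all systems of
   homogeneous coordinates of P. *)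
Definition vanishes_at (f : {mpoly K[n.+1]}) P : Prop :=
  forall v, hcoord P v -> f.@[v 0] = 0.

Definition zeros (S : set {mpoly K[n.+1]}) : set (proj K n) :=
  [set P | forall f, S f -> vanishes_at f P].

Definition homogeneous (f : {mpoly K[n.+1]}) : Prop :=
  exists e : nat, f \is e.-homog.

Definition algebraic_set X : Prop :=
  exists S : set {mpoly K[n.+1]},
    (forall f, S f -> homogeneous f) /\ X = zeros S.

Definition vanishing_ideal X : set {mpoly K[n.+1]} :=
  [set f | forall P, X P -> vanishes_at f P].

Definition ideal_gen (r : nat) (f : 'I_r -> {mpoly K[n.+1]}) :
    set {mpoly K[n.+1]} :=
  [set g | exists h : 'I_r -> {mpoly K[n.+1]}, g = \sum_(i < r) h i * f i].

Definition irreducible_set Z : Prop :=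
  Z !=set0 /\
  forall A B, algebraic_set A -> algebraic_set B ->
    Z `<=` A `|` B -> Z `<=` A \/ Z `<=` B.

(* A chain C 0 < ... < C k of irreducible algebraic subsets of X; the values
   C i for k < i are irrelevant. *)
Definition irreducible_chain X (k : nat) (C : nat -> set (proj K n)) : Prop :=
  (forall i, (i <= k)%N ->
     [/\ algebraic_set (C i), irreducible_set (C i) & C i `<=` X]) /\
  (forall i, (i < k)%N -> C i `<` C i.+1).

(* Krull dimension for the Zariski topology; the empty set has none. *)
Definition has_dim X (m : nat) : Prop :=
  (exists C, irreducible_chain X m C) /\
  (forall k C, irreducible_chain X k C -> (k <= m)%N).

(* The generators are nonzero since 0 is e.-homog for every e. *)
Definition has_multidegree X (r : nat) (delta : 'I_r -> nat) : Prop :=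
  [/\ algebraic_set X,
      exists2 m, has_dim X m & (m + r = n)%N
    & exists f : 'I_r -> {mpoly K[n.+1]},
        (forall i, f i != 0 /\ f i \is (delta i).-homog) /\
        vanishing_ideal X = ideal_gen f].

Definition ideal_complete_intersection X : Prop :=
  exists (r : nat) (delta : 'I_r -> nat), has_multidegree X delta.

Definition linear_variety (k : nat) (M : 'M[K]_(k.+1, n.+1)) :
    set (proj K n) :=
  [set P | forall v, hcoord P v -> (v <= M)%MS].

(* Q L for almost all linear varieties L of dimension k: the exceptional L are
   those having all their bases (rows of M) in a fixed proper Zariski closed
   subset of the space of matrices. *)
Definition almost_all_linear (k : nat) (Q : set (proj K n) -> Prop) : Prop :=
  exists2 G : {mpoly K[k.+1 * n.+1]}, G != 0 &
    forall M : 'M[K]_(k.+1, n.+1),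
      row_free M -> G.@[mxvec M 0] != 0 -> Q (linear_variety M).

Definition has_degree X (d : nat) : Prop :=
  exists2 m, has_dim X m &
    almost_all_linear (n - m) (fun L => (X `&` L #= `I_d)%card).

Definition affine_part X : set (proj K n) :=
  X `&` [set P | ~ vanishes_at 'X_ord0 P].

(* coord i is the index i + 1, as 'I_r starts at 0. *)
Definition coord (r : nat) (hrn : (r <= n)%N) (i : 'I_r) : 'I_n.+1 :=
  lift ord0 (widen_ord hrn i).

Definition tubular_component (r : nat) (hrn : (r <= n)%N) (b : 'I_r -> K) :
    set (proj K n) :=
  [set P | forall i, vanishes_at ('X_(coord hrn i) - b i *: 'X_ord0) P].

Definition tubular_set (r : nat) (hrn : (r <= n)%N) (d : 'I_r -> nat)
    (a : forall i, 'I_(d i) -> K) : set (proj K n) :=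
  \bigcup_(J in [set: forall i, 'I_(d i)])
     tubular_component hrn (fun i => a i (J i)).

End ProjectiveSets.

Section BaseField.
Variables (F K : fieldType) (iota : {rmorphism F -> K}) (n : nat).
Implicit Types X : set (proj K n).

Definition defined_over X : Prop :=
  exists (k : nat) (g : 'I_k -> {mpoly F[n.+1]}),
    (forall i, homogeneous (g i)) /\
    vanishing_ideal X = ideal_gen (fun i => map_mpoly iota (g i)).

Definition rational_points X : set (proj K n) :=
  X `&` [set P | exists w : 'rV[F]_n.+1, hcoord P (map_mx iota w)].

End BaseField.

(* pi_ q l = q^l + ... + q + 1 for l >= 0, and 0 for l < 0. *)
Definition pi_ (q : nat) (l : int) : nat :=
  if l is Posz l' then (\sum_(0 <= i < l'.+1) q ^ i)%N else 0%N.

(* Main.v *)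
Require Import Defs.
From HB Require Import structures.
From mathcomp Require Import all_boot all_order all_algebra all_field.
From mathcomp Require Import boolp classical_sets functions cardinality.
From mathcomp Require Import mpoly.

Set Implicit Arguments.
Unset Strict Implicit.
Unset Printing Implicit Defensive.

Import GRing.Theory.
Local Open Scope classical_set_scope.
Local Open Scope ring_scope.

(* The ideal of X is generated by the forms g_i = prod_j (T_i - a_ij T_0): one
   peels off the factors T_i - a_ij T_0 one at a time, the remainder of a
   polynomial modulo such a factor being obtained by the substitution
   T_i := a_ij T_0, until only polynomials vanishing on all of T_0 <> 0 remain.

   A chain C_0 < ... < C_k of irreducible subsets of X lies in a single
   component, which is parametrized by K^(m+1). Choose forms g_i vanishing on
   C_(i-1) but not on C_i, and a coordinate g_0 not vanishing on C_0. If k > m,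
   these k+1 forms are algebraically dependent (count monomials), and a weighted
   homogeneous relation contradicts the primality of the ideals of the C_i.

   Two components meet only in T_0 = 0, where they all coincide. Hence a linear
   variety spanned by a matrix whose first r+1 columns are independent meets each
   component in one point with T_0 <> 0, and the rational points of X are the
   d q^m affine ones together with the points of a projective space of
   dimension m-1 at infinity. *)

(** * Polynomials determined by their values *)

(** The lowest digit is the remainder modulo B and the other digits come from the quotient. This
    keeps the exponents of a Kronecker substitution apart. *)
Lemma digits_inj (n B : nat) (a b : 'I_n -> nat) :
  (forall i, a i < B)%N -> (forall i, b i < B)%N ->
  (\sum_i a i * B ^ i = \sum_i b i * B ^ i)%N -> a =1 b.
Proof.
elim: n a b => [|n IHn] a b aB bB eq_ab i; first by case: i.
have B0 : (0 < B)%N by apply: leq_ltn_trans (aB i).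
have splitB (c : 'I_n.+1 -> nat) : (\sum_i c i * B ^ i =
    (\sum_(i < n) c (lift ord0 i) * B ^ i) * B + c ord0)%N.
  rewrite big_ord_recl muln1 addnC big_distrl /=; congr (_ + _)%N.
  by apply: eq_bigr => j _; rewrite /bump add1n expnSr mulnA.
move: eq_ab; rewrite !splitB => eq_ab.
have eq0 : a ord0 = b ord0.
  by have := congr1 (modn^~ B) eq_ab; rewrite !modnMDl !modn_small.
have eqS : (\sum_(j < n) a (lift ord0 j) * B ^ j
          = \sum_(j < n) b (lift ord0 j) * B ^ j)%N.
  by have := congr1 (divn^~ B) eq_ab; rewrite !divnMDl // !divn_small ?addn0.
by case: (unliftP ord0 i) => [j|] ->; [exact: (IHn _ _ _ _ eqS j)|].
Qed.

Lemma horner_mmap (R : comNzRingType) (n : nat) (p : 'I_n -> {poly R})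
    (f : {mpoly R[n]}) (t : R) :
  (mmap polyC p f).[t] = f.@[fun i => (p i).[t]].
Proof.
rewrite /mmap mevalE horner_sum; apply: eq_bigr => m _.
rewrite hornerM hornerC; congr (_ * _).
by rewrite /mmap1 horner_prod; apply: eq_bigr => i _; rewrite horner_exp.
Qed.

Lemma horner_eq0 (K : closedFieldType) (p : {poly K}) :
  (forall t, p.[t] = 0) -> p = 0.
Proof.
move=> p0; apply/eqP/negPn/negP => /closed_nonrootP[t].
by rewrite /root p0 eqxx.
Qed.

(* Kronecker's substitution T_i := t ^ (B ^ i) keeps distinct monomials with
   exponents below B distinct. *)
Lemma meval_eq0 (K : closedFieldType) (n : nat) (f : {mpoly K[n]}) :
  (forall v, f.@[v] = 0) -> f = 0.
Proof.
move=> f0; set B := msize f.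
have degB (m : 'X_{1..n}) i : m \in msupp f -> (m i < B)%N.
  move=> mf; apply: leq_ltn_trans (msize_mdeg_lt mf).
  by rewrite mdegE (bigD1 i) //= leq_addr.
pose ka (m : 'X_{1..n}) := (\sum_i m i * B ^ i)%N.
pose p := mmap polyC (fun i : 'I_n => 'X^(B ^ i)) f.
have p0 : p = 0 by apply: horner_eq0 => t; rewrite horner_mmap f0.
have pE : p = \sum_(m <- msupp f) f@_m *: 'X^(ka m).
  apply: eq_bigr => m _; rewrite mul_polyC; congr (_ *: _).
  rewrite /mmap1 /ka expr_sum; apply: eq_bigr => i _.
  by rewrite mulnC exprM.
apply/mpolyP => m; rewrite mcoeff0.
case: (boolP (m \in msupp f)) => [mf|]; last exact: memN_msupp_eq0.
have := congr1 (fun q : {poly K} => q`_(ka m)) p0.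
rewrite pE coef_sum coef0 (bigD1_seq m) ?msupp_uniq //=.
rewrite coefZ coefXn eqxx mulr1 big_seq_cond big1 ?addr0 // => m' /andP[m'f m'm].
rewrite coefZ coefXn; case: eqP => [eqk|_]; last by rewrite mulr0.
case/eqP: m'm; apply/mnmP => i; symmetry.
by apply: (@digits_inj n B m m') => // j; apply: degB.
Qed.

Lemma meval_scale (R : comNzRingType) (n e : nat) (f : {mpoly R[n]})
    (c : R) (v : 'I_n -> R) :
  f \is e.-homog -> f.@[fun i => c * v i] = c ^+ e * f.@[v].
Proof.
move=> /dhomogP fe; rewrite !mevalE mulr_sumr big_seq [RHS]big_seq.
apply: eq_bigr => m /fe me; rewrite mulrCA; congr (_ * _).
have <- : mdeg m = e := me.
rewrite mdegE expr_sum -big_split /=.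
by apply: eq_bigr => i _; rewrite exprMn.
Qed.

(** * Points and irreducible sets *)

Section Points.
Variables (K : fieldType) (n : nat).
Implicit Types (P Q : proj K n) (v w : 'rV[K]_n.+1) (f : {mpoly K[n.+1]}).

Lemma hcoord_ex P : exists v, hcoord P v.
Proof.
case: P => L dimL; exists (vpick L); split; last exact: memv_pick.
by rewrite vpick0 -dimv_eq0 (eqP dimL).
Qed.

Lemma point_ex v : v != 0 -> exists P, hcoord P v.
Proof.
move=> v0; have dimv : \dim <[v]>%VS == 1%N by rewrite dim_vline v0.
by exists (exist _ <[v]>%VS dimv); split => //=; exact: memv_line.
Qed.

Lemma hcoord_line P v : hcoord P v -> val P = <[v]>%VS.
Proof.
case: P => L dimL [/= v0 vL]; apply/esym/eqP; rewrite eqEdim.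
by rewrite -memvE vL dim_vline v0 (eqP dimL).
Qed.

Lemma hcoord_inj P Q v : hcoord P v -> hcoord Q v -> P = Q.
Proof. by move=> /hcoord_line PE /hcoord_line QE; apply: val_inj; rewrite PE. Qed.

Lemma hcoordZ P v (c : K) : c != 0 -> hcoord P v -> hcoord P (c *: v).
Proof.
by move=> c0 [v0 vP]; split; rewrite ?memvZ // scaler_eq0 negb_or c0.
Qed.

Lemma hcoord_scale P v w :
  hcoord P v -> hcoord P w -> exists2 c, c != 0 & w = c *: v.
Proof.
move=> Pv [w0]; rewrite (hcoord_line Pv) => /vlineP[c wE].
by exists c => //; apply: contraNneq w0 => c0; rewrite wE c0 scale0r.
Qed.

(** Rescaling the coordinates by c multiplies the value of a form of degree e by c ^ e, so a single
    coordinate vector decides. *)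
Lemma vanishes_atE f P v :
  homogeneous f -> hcoord P v -> vanishes_at f P <-> f.@[v 0] = 0.
Proof.
move=> [e fe] Pv; split=> [|fv w /(hcoord_scale Pv)[c _ ->]]; first exact.
rewrite -[RHS](mulr0 (c ^+ e)) -fv -meval_scale //.
by apply: meval_eq => i; rewrite mxE.
Qed.

Lemma homogeneousM f g :
  homogeneous f -> homogeneous g -> homogeneous (f * g).
Proof. by case=> [e fe] [e' ge]; exists (e + e')%N; apply: dhomogM. Qed.

Lemma homogeneous_prod (I : Type) (s : seq I) (F : I -> {mpoly K[n.+1]}) :
  (forall i, homogeneous (F i)) -> homogeneous (\prod_(i <- s) F i).
Proof.
move=> hF; elim: s => [|i s IHs]; first by rewrite big_nil; exists 0%N; exact: dhomog1.
by rewrite big_cons; apply: homogeneousM.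
Qed.

Lemma algebraic_zeros1 f : homogeneous f -> algebraic_set (zeros [set f]).
Proof. by move=> hf; exists [set f]; split=> // g ->. Qed.

(** At each point of Z one of the factors vanishes, so the zero sets of f and g cover Z and
    irreducibility puts Z inside one of them. *)
Lemma irreducibleM (Z : set (proj K n)) f g :
    irreducible_set Z -> homogeneous f -> homogeneous g ->
  vanishing_ideal Z (f * g) -> vanishing_ideal Z f \/ vanishing_ideal Z g.
Proof.
move=> [_ irrZ] hf hg fgZ.
have [] := irrZ _ _ (algebraic_zeros1 hf) (algebraic_zeros1 hg).
- move=> P ZP; have [v Pv] := hcoord_ex P.
  have /eqP := fgZ P ZP v Pv; rewrite mevalM mulf_eq0 => /orP[]/eqP fv0.
    by left=> _ ->; apply/(vanishes_atE hf Pv).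
  by right=> _ ->; apply/(vanishes_atE hg Pv).
- by move=> Zf; left=> P /Zf; apply.
- by move=> Zg; right=> P /Zg; apply.
Qed.

Lemma irreducible_prod (I : Type) (s : seq I) (F : I -> {mpoly K[n.+1]})
    (Z : set (proj K n)) :
    irreducible_set Z -> (forall i, homogeneous (F i)) ->
  vanishing_ideal Z (\prod_(i <- s) F i) -> exists i, vanishing_ideal Z (F i).
Proof.
move=> irrZ hF; have [[P ZP] _] := irrZ; have [v Pv] := hcoord_ex P.
elim: s => [|i s IHs].
  by move=> /(_ P ZP v Pv)/eqP; rewrite big_nil meval1 oner_eq0.
rewrite big_cons => /(irreducibleM irrZ (hF i) (homogeneous_prod _ hF))[].
  by move=> Fi; exists i.
exact: IHs.
Qed.

Lemma irreducibleX (Z : set (proj K n)) f k :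
    irreducible_set Z -> homogeneous f ->
  vanishing_ideal Z (f ^+ k) -> vanishing_ideal Z f.
Proof.
move=> irrZ hf; rewrite -[k]card_ord -prodr_const => fk.
by have [] := irreducible_prod irrZ (fun=> hf) fk.
Qed.
End Points.

(* Two polynomials not vanishing at two given points are both nonzero at some
   point of the line joining them. *)
Lemma irreducible_linear (K : closedFieldType) (n : nat)
    (W : 'rV[K]_n.+1 -> Prop) (Z : set (proj K n)) :
    (forall v w t, W v -> W w -> W (v + t *: w)) ->
    (forall P v, hcoord P v -> Z P <-> W v) -> Z !=set0 ->
  irreducible_set Z.
Proof.
move=> Wlin ZW Z0; split=> // A B [SA [hA ->]] [SB [hB ->]] ZAB.
apply: contrapT => /not_orP[/existsNP[P /not_implyP[ZP /existsNP[f]]]].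
move=> /not_implyP[Sf fP] /existsNP[Q /not_implyP[ZQ /existsNP[g]]].
move=> /not_implyP[Sg gQ].
have [v Pv] := hcoord_ex P; have [w Qw] := hcoord_ex Q.
have {}fP : f.@[v 0] != 0 by apply/eqP => /(vanishes_atE (hA _ Sf) Pv).
have {}gQ : g.@[w 0] != 0 by apply/eqP => /(vanishes_atE (hB _ Sg) Qw).
have Wv : W v by exact/(ZW _ _ Pv).
have Ww : W w by exact/(ZW _ _ Qw).
have /rV0Pn[c vc] : v != 0 by case: Pv.
(* [u] lists the coordinates, as polynomials in t, of a vector moving from v at t = 0 to w at t =
   1. *)
pose u i : {poly K} := (v 0 i)%:P + 'X * (w 0 i - v 0 i)%:P.
have uE t i : (u i).[t] = (v + t *: (w - v)) 0 i.
  by rewrite /u hornerD hornerM hornerX !hornerC !mxE.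
have mE h t : (mmap polyC u h).[t] = h.@[(v + t *: (w - v)) 0].
  by rewrite horner_mmap; apply: meval_eq => i; rewrite uE.
have nz0 (p : {poly K}) t : p.[t] != 0 -> p != 0.
  by apply: contraNneq => ->; rewrite horner0.
(* The factor [u c], nonzero at t = 0, ensures that a non-root t gives a nonzero vector, hence a
   point. *)
have : mmap polyC u f * mmap polyC u g * u c != 0.
  rewrite !mulf_neq0 //.
  - by apply: (nz0 _ 0); rewrite mE scale0r addr0.
  - by apply: (nz0 _ 1); rewrite mE scale1r addrC subrK.
  - by apply: (nz0 _ 0); rewrite uE scale0r addr0.
move=> /closed_nonrootP[t]; rewrite rootE !hornerM !mE uE !mulf_eq0 !negb_or.
set x := v + _ => /andP[/andP[fx gx] xc].
have x0 : x != 0 by apply: contraNneq xc => ->; rewrite mxE.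
have Wx : W x.
  have -> : x = (v + (- t) *: v) + t *: w.
    by rewrite /x scalerBr scaleNr addrCA addrC.
  exact/(Wlin _ _ _ _ Ww)/Wlin.
have [R Rx] := point_ex x0.
have /ZAB[RA|RB] : Z R by exact/(ZW _ _ Rx).
- by move/eqP: fx; apply; apply: (RA f).
- by move/eqP: gx; apply; apply: (RB g).
Qed.

(** * Length of chains of irreducible sets *)

Lemma dhomog_prod_exp (R : comNzRingType) (n : nat) (I : Type) (s : seq I)
    (g : I -> {mpoly R[n]}) (w e : I -> nat) :
  (forall i, g i \is (w i).-homog) ->
  \prod_(i <- s) g i ^+ e i \is (\sum_(i <- s) e i * w i)%N.-homog.
Proof.
move=> gw; elim: s => [|i s IHs]; first by rewrite !big_nil dhomog1.
by rewrite !big_cons mulnC; apply: dhomogM => //; exact: dhomogMn.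
Qed.

(* The least power of the last polynomial g i can be divided out, and the terms
   still divisible by g i then vanish on the previous member of the chain. *)
Lemma chain_no_relation (K : fieldType) (n k : nat) (C : nat -> set (proj K n))
    (g : nat -> {mpoly K[n.+1]}) (w : nat -> nat) :
    (forall i, (i <= k)%N -> irreducible_set (C i)) ->
    (forall i, (i < k)%N -> C i `<=` C i.+1) ->
    (forall i, g i \is (w i).-homog) -> (0 < w 0)%N ->
    (forall i, (i < k)%N -> vanishing_ideal (C i) (g i.+1)) ->
    (forall i, (i <= k)%N -> ~ vanishing_ideal (C i) (g i)) ->
  forall i, (i <= k)%N ->
  forall (I : finType) (A : pred I) (e : I -> nat -> nat) (c : I -> K) (s : nat),
    (exists x, A x) -> (forall x, A x -> c x != 0) ->
    (forall x, A x -> (\sum_(j < i.+1) e x j * w j = s)%N) ->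
    (forall x y, A x -> A y -> (forall j, (j <= i)%N -> e x j = e y j) -> x = y) ->
  ~ vanishing_ideal (C i) (\sum_(x | A x) c x *: \prod_(j < i.+1) g j ^+ e x j).
Proof.
move=> irrC subC gw w0 gC gNC; elim=> [|i IHi] lik I A e c s [x0 Ax0] c0 es inj_e.
  (* Base case: since [w 0] is positive, the common weight s fixes the exponent of [g 0], and
     injectivity leaves a single term. *)
  rewrite (big_pred1 x0) => [|x]; last first.
    apply/idP/eqP => [Ax|->//]; apply: inj_e => // j; rewrite leqn0 => /eqP->.
    have := es x Ax; rewrite -(es x0 Ax0) !big_ord1 => /eqP.
    by rewrite eqn_pmul2r // => /eqP.
  rewrite big_ord1 => g0; apply: (gNC 0%N lik).
  apply: (@irreducibleX _ _ _ _ (e x0 0%N)); [exact: irrC|by exists (w 0%N)|].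
  move=> P CP v Pv; have /eqP := g0 P CP v Pv.
  by rewrite mevalZ mulf_eq0 (negPf (c0 _ Ax0)) => /eqP.
have [x1 Ax1 min_x1] := arg_minnP (fun x => e x i.+1) Ax0.
set e0 := e x1 i.+1 in min_x1.
pose h x := \prod_(j < i.+1) g j ^+ e x j.
have hw x : h x \is (\sum_(j < i.+1) e x j * w j)%N.-homog.
  exact: dhomog_prod_exp.
(* T is the relation divided by [g i.+1 ^ e0]; it is again homogeneous, as the primality argument on
   [C i.+1] requires. *)
pose T := \sum_(x | A x) c x *: (h x * g i.+1 ^+ (e x i.+1 - e0)).
have T_homog : homogeneous T.
  exists (s - e0 * w i.+1)%N; apply: rpred_sum => x Ax; apply: rpredZ.
  rewrite -(es x Ax) big_ord_recr -addnBA ?leq_mul2r ?min_x1 ?orbT //=.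
  by rewrite -mulnBl; apply: dhomogM => //; rewrite mulnC; exact: dhomogMn.
move=> gT.
have {gT} TC : vanishing_ideal (C i.+1) T.
  have [] := @irreducibleM _ _ (C i.+1) (g i.+1 ^+ e0) T (irrC _ lik) _ T_homog.
  - by exists (w i.+1 * e0)%N; exact: dhomogMn.
  - move=> P CP v Pv; rewrite -[RHS](gT P CP v Pv); congr meval.
    rewrite mulr_sumr; apply: eq_bigr => x Ax.
    by rewrite big_ord_recr -scalerAr mulrCA -exprD subnKC ?min_x1.
  - move/(irreducibleX (irrC _ lik)) => gC'.
    by case: (gNC _ lik); apply: gC'; exists (w i.+1).
  - by [].
pose A' := [pred x | A x & e x i.+1 == e0].
apply: (IHi (ltnW lik) I A' e c (s - e0 * w i.+1)%N).
- by exists x1; rewrite /= Ax1 eqxx.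
- by move=> x /andP[/c0].
- by move=> x /andP[Ax /eqP ex]; rewrite -(es x Ax) [in RHS]big_ord_recr /= ex addnK.
- move=> x y /andP[Ax /eqP ex] /andP[Ay /eqP ey] exy; apply: inj_e => // j.
  by rewrite leq_eqVlt => /predU1P[->|/exy//]; rewrite ex ey.
move=> P CP v Pv; rewrite -[RHS](TC P (subC i lik P CP) v Pv) !raddf_sum.
rewrite [LHS]big_mkcondr; apply: eq_bigr => x Ax.
rewrite /= !mevalZ mevalM rmorphXn /= (gC i lik P CP v Pv) expr0n subn_eq0.
by case: ltngtP (min_x1 x Ax) => // _ _; rewrite ?mulr1 ?mulr0.
Qed.

(** [msize] is the degree plus one, and 0 for the zero polynomial, so this is additivity of degrees
    in a form that tolerates zero factors. *)
Lemma msize_prod_exp (R : idomainType) (n : nat) (I : Type) (s : seq I)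
    (g : I -> {mpoly R[n]}) (e : I -> nat) :
  (msize (\prod_(i <- s) g i ^+ e i) <= (\sum_(i <- s) e i * msize (g i)).+1)%N.
Proof.
have sizeM (p q : {mpoly R[n]}) a b : (msize p <= a.+1)%N -> (msize q <= b.+1)%N ->
    (msize (p * q) <= (a + b).+1)%N.
  have [->|p0] := eqVneq p 0; first by rewrite mul0r msize0.
  have [->|q0] := eqVneq q 0; first by rewrite mulr0 msize0.
  move=> pa qb; rewrite msizeM // -subn1 leq_subLR add1n -addnS -addSn.
  exact: leq_add.
elim: s => [|i s IHs]; first by rewrite !big_nil msize1.
rewrite !big_cons; apply: (sizeM) => //.
elim: (e i) => [|m IHm]; first by rewrite msize1.
by rewrite exprS mulSn; apply: (sizeM) => //; exact: leqnSn.
Qed.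

Lemma card_bmultinom (p b : nat) : (#|{: 'X_{1..p < b}}| <= b ^ p)%N.
Proof.
have degb (m : 'X_{1..p < b}) i : (m i < b)%N.
  by apply: leq_ltn_trans (bmdeg m); rewrite mdegE (bigD1 i) //= leq_addr.
pose f (m : 'X_{1..p < b}) := [ffun i => Ordinal (degb m i)].
have /leq_card : injective f.
  move=> m m' /ffunP eq_f; apply/val_inj/mnmP => i.
  by have := eq_f i; rewrite !ffunE => /(congr1 val).
by rewrite card_ffun !card_ord.
Qed.

(* N ^ k products of powers below N lie in a space of dimension O(N ^ p). *)
Lemma algebraic_dependence (K : fieldType) (p k : nat)
    (G : 'I_k -> {mpoly K[p]}) : (p < k)%N ->
  exists (N : nat) (c : {ffun 'I_k -> 'I_N} -> K),
    (exists x, c x != 0) /\ \sum_x c x *: \prod_j G j ^+ x j = 0.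
Proof.
(* The choice of N gives b ^ p = N ^ p * D ^ p < N ^ p.+1 <= N ^ k, where b = N * D bounds the size
   of every product. *)
move=> ltpk; pose D := (\sum_j msize (G j)).+1; pose N := (D ^ p).+1.
pose b := (N * D)%N; exists N.
have msizeb (x : {ffun 'I_k -> 'I_N}) : (msize (\prod_j G j ^+ x j) <= b)%N.
  apply: leq_trans (msize_prod_exp _ _ _) _.
  rewrite /b mulnS -add1n leq_add // big_distrr leq_sum // => j _.
  by rewrite leq_mul2r ltnW ?orbT.
(* Row x holds the coefficients of the product with exponents x. There are more rows than columns,
   and a nonzero vector of the left kernel is a linear relation between the products. *)
pose M := \matrix_(x < #|{ffun 'I_k -> 'I_N}|, m < #|{: 'X_{1..p < b}}|)
  (\prod_j G j ^+ (enum_val x) j)@_(enum_val m).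
have : kermx M != 0.
  rewrite kermx_eq0 /row_free neq_ltn (leq_ltn_trans (rank_leq_col M)) //.
  apply: leq_ltn_trans (card_bmultinom _ _) _.
  rewrite card_ffun !card_ord /b expnMn -(subnKC (ltnW ltpk)) expnD.
  rewrite ltn_pmul2l ?expn_gt0 //; apply: (@leq_trans N) => //.
  by rewrite -[leqLHS]expn1 leq_pexp2l // subn_gt0.
case/rowV0Pn => u /sub_kermxP uM u0; exists (fun x => u 0 (enum_rank x)).
split.
  have /rV0Pn[i ui] := u0; exists (enum_val i); by rewrite enum_valK.
apply/mpolyP => m; rewrite mcoeff0 raddf_sum /=.
have [mb|mb] := ltnP (mdeg m) b; last first.
  apply: big1 => x _; rewrite mcoeffZ memN_msupp_eq0 ?mulr0 //.
  by apply: msize_mdeg_ge; exact: leq_trans mb.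
have := congr1 (fun B : 'rV_ _ => B 0 (enum_rank (BMultinom mb))) uM.
rewrite !mxE => uM0; rewrite -[RHS]uM0 [RHS](reindex (@enum_rank _)) /=; last first.
  exact/onW_bij/enum_rank_bij.
by apply: eq_bigr => x _; rewrite mcoeffZ mxE !enum_rankK.
Qed.

(** The hypothesis places the cone over Z in the image of a polynomial map from K^p. Pulled back
    along it, k + 1 forms become dependent as soon as p <= k; a space parametrized by K^(m+1) thus
    gets the bound k <= m. *)
Lemma irreducible_chain_length (K : closedFieldType) (n p : nat)
    (phi : 'I_n.+1 -> {mpoly K[p]}) (Z : set (proj K n)) :
    (forall P v, Z P -> hcoord P v -> exists x, forall i, v 0 i = (phi i).@[x]) ->
  forall k C, irreducible_chain Z k C -> (k < p)%N.
Proof.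
move=> Zphi k C [irrC ltC]; rewrite ltnNge; apply/negP => lepk.
have subC i : (i < k)%N -> C i `<=` C i.+1 by case/ltC.
have [[P0 CP0] _] : irreducible_set (C 0%N) by have [] := irrC 0%N (leq0n k).
have [v0 P0v0] := hcoord_ex P0.
have /rV0Pn[c0 v0c] : v0 != 0 by case: P0v0.
have g_ex i : exists gw : {mpoly K[n.+1]} * nat, [/\ gw.1 \is (gw.2).-homog,
    (i < k)%N -> vanishing_ideal (C i) gw.1
    & (i < k)%N -> ~ vanishing_ideal (C i.+1) gw.1].
  (* Beyond the chain, the zero polynomial in degree 0 is a default value. *)
  have [ik|_] := ltnP i k; last by exists (0, 0%N); split => //; exact: dhomog0.
  have [_ /existsNP[P /not_implyP[CP PC]]] := ltC i ik.
  have [[S [hS CE]] _ _] := irrC i (ltnW ik).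
  move: PC; rewrite CE => /existsNP[f /not_implyP[Sf fP]].
  have [e fe] := hS f Sf; exists (f, e); split=> //= _; first by move=> Q; apply.
  move=> fC; apply: fP; exact: fC.
have [g gP] := choice g_ex.
(* Shift of indices: [gs j.+1] vanishes on [C j] but not on [C j.+1], and [gs 0] is a coordinate
   that is nonzero at a point of [C 0]. *)
pose gs i := if i is j.+1 then (g j).1 else 'X_c0.
pose ws i := if i is j.+1 then (g j).2 else 1%N.
have gsw i : gs i \is (ws i).-homog.
  by case: i => [|i] /=; [rewrite dhomogX; apply/eqP/mdeg1|case: (gP i)].
have [N [c [[x0 cx0] rel]]] :=
  algebraic_dependence (fun j : 'I_k.+1 => gs j \mPo [tuple phi i | i < n.+1])
    (lepk : (p < k.+1)%N).
pose wt (x : {ffun 'I_k.+1 -> 'I_N}) := (\sum_j x j * ws j)%N.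
pose ex (x : {ffun 'I_k.+1 -> 'I_N}) j : nat := x (inord j).
(* Only the terms with the weight of [x0] are kept, since the relation need not be homogeneous. *)
pose A x := (c x != 0) && (wt x == wt x0).
have evE (Q : proj K n) v : Z Q -> hcoord Q v ->
    \sum_x c x * \prod_(j < k.+1) (gs j).@[v 0] ^+ x j = 0.
  move=> ZQ Qv; have [y vy] := Zphi Q v ZQ Qv.
  have := congr1 (meval y) rel; rewrite meval0 raddf_sum /= => rel_y.
  rewrite -[RHS]rel_y.
  apply: eq_bigr => x _; rewrite mevalZ rmorph_prod; congr (_ * _).
  apply: eq_bigr => j _; rewrite rmorphXn /= comp_mpoly_meval; congr (_ ^+ _).
  by apply: meval_eq => i; rewrite tnth_mktuple.
apply: (@chain_no_relation K n k C gs ws _ subC gsw _ _ _ k (leqnn k) _ A ex c (wt x0)).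
- by move=> i /irrC[].
- by [].
- by move=> i ik; have [_ /(_ ik)] := gP i.
- case=> [_ /(_ P0 CP0 v0 P0v0)/eqP|i ik]; last by have [_ _ /(_ ik)] := gP i.
  by rewrite mevalXU (negPf v0c).
- by exists x0; rewrite /A cx0 eqxx.
- by move=> x /andP[].
- move=> x /andP[_ /eqP <-]; apply: eq_bigr => j _.
  by rewrite /ex inord_val.
- move=> x y _ _ exy; apply/ffunP => j; apply: val_inj.
  by have := exy j (ltn_ord j); rewrite /ex inord_val.
move=> Q CQ v Qv.
have ZQ : Z Q by have [_ _] := irrC k (leqnn k); apply.
pose F x := c x * \prod_(j < k.+1) (gs j).@[v 0] ^+ x j.
(* Rescaling v by t multiplies the part of weight s of the relation by t ^ s. As a polynomial in t
   the relation is therefore zero, and so is each of its weighted parts at Q. *)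
pose q : {poly K} := \sum_x F x *: 'X^(wt x).
have q0 : q = 0.
  (* The factor 'X takes care of t = 0, where [t *: v] represents no point. *)
  suff : 'X * q = 0 by move/eqP; rewrite mulf_eq0 polyX_eq0 => /eqP.
  apply: horner_eq0 => t; rewrite hornerM hornerX.
  have [->|t0] := eqVneq t 0; first by rewrite mul0r.
  rewrite -[RHS](mulr0 t) -(evE Q _ ZQ (hcoordZ t0 Qv)) horner_sum.
  congr (_ * _); apply: eq_bigr => x _.
  rewrite hornerZ hornerXn /F -mulrA; congr (_ * _).
  rewrite expr_sum -big_split; apply: eq_bigr => j _ /=.
  rewrite mulnC exprM -exprMn mulrC -(meval_scale _ _ (gsw j)); congr (_ ^+ _).
  by apply: meval_eq => i; rewrite mxE.
have := congr1 (fun r : {poly K} => r`_(wt x0)) q0.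
rewrite coef0 coef_sum raddf_sum /= => qs; rewrite -[RHS]qs big_mkcond.
apply: eq_bigr => x _; rewrite /A coefZ coefXn [wt x0 == _]eq_sym.
case: (boolP (wt x == _)) => _; rewrite ?andbF ?mulr0 // andbT mulr1.
case: (boolP (c x != 0)) => [_|/negPn/eqP cx]; last by rewrite /F cx mul0r.
rewrite mevalZ rmorph_prod; congr (_ * _).
by apply: eq_bigr => j _; rewrite rmorphXn /ex inord_val.
Qed.

(** * The ideal of a tubular set *)

(** Congruence modulo L respects sums and products, so it passes from the variables to monomials and
    then to all polynomials. *)
Lemma comp_mpoly_congr (R : comNzRingType) (n : nat)
    (lq : n.-tuple {mpoly R[n]}) (L : {mpoly R[n]}) :
    (forall i, exists h, 'X_i - tnth lq i = h * L) ->
  forall f, exists h, f - (f \mPo lq) = h * L.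
Proof.
move=> lqL; pose cong x y := exists h, x - y = h * L.
have congM x y x' y' : cong x y -> cong x' y' -> cong (x * x') (y * y').
  move=> [h xy] [h' xy']; exists (x * h' + h * y').
  by rewrite mulrDl -[x * _ * _]mulrA -xy' mulrAC -xy mulrBr mulrBl addrA subrK.
have cong1 : cong 1 1 by exists 0; rewrite subrr mul0r.
have congX m : cong 'X_[m] ('X_[m] \mPo lq).
  rewrite comp_mpolyX mpolyXE_id; elim/big_rec2: _ => // i x y _; apply: (congM).
  elim: (m i) => [|k IHk]; first by rewrite !expr0.
  by rewrite !exprS; exact: congM (lqL i) IHk.
elim/mpolyind=> [|c m p _ _ [h ph]]; first by exists 0; rewrite comp_mpoly0 subrr mul0r.
have [h' mh'] := congX m; exists (c *: h' + h).
rewrite comp_mpolyD comp_mpolyZ opprD addrACA ph -scalerBr mh'.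
by rewrite mulrDl scalerAl.
Qed.

Section Tubular.
Variables (K : fieldType) (n r : nat) (hrn : (r <= n)%N).
Variables (d : 'I_r -> nat) (a : forall i, 'I_(d i) -> K).
Implicit Types (P : proj K n) (f : {mpoly K[n.+1]}) (v : 'I_n.+1 -> K).

Local Notation c := (Defs.coord hrn).
Local Notation X := (tubular_set hrn a).

Definition tubular_lin (i : 'I_r) (b : K) : {mpoly K[n.+1]} := 'X_(c i) - b *: 'X_ord0.

Definition tubular_gen (i : 'I_r) : {mpoly K[n.+1]} :=
  \prod_(j < d i) tubular_lin i (a j).

Lemma tubular_linE i b v : (tubular_lin i b).@[v] = v (c i) - b * v ord0.
Proof. by rewrite mevalB mevalZ !mevalXU. Qed.

Lemma tubular_lin_homog i b : tubular_lin i b \is 1.-homog.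
Proof.
by rewrite rpredB ?rpredZ //; rewrite dhomogX; apply/eqP/mdeg1.
Qed.

Lemma tubular_lin_homogeneous i b : homogeneous (tubular_lin i b).
Proof. by exists 1%N; exact: tubular_lin_homog. Qed.

Lemma tubular_gen_homog i : tubular_gen i \is (d i).-homog.
Proof.
have := dhomog_prod_exp (index_enum 'I_(d i)) (fun=> 1%N)
  (fun j => tubular_lin_homog i (a j)).
by rewrite sum_nat_const card_ord !muln1.
Qed.

Lemma coord_neq0 i : (ord0 == c i) = false.
Proof. by rewrite (negPf (neq_lift _ _)). Qed.

Lemma coord_inj : injective c.
Proof. by move=> i i' cc; apply: val_inj; exact: (congr1 val (lift_inj cc)). Qed.

Lemma tubular_gen_neq0 i : tubular_gen i != 0.
Proof.
(* At the unit vector of index [c i] every factor takes the value 1. *)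
apply/eqP => /(congr1 (meval (fun k => (k == c i)%:R))).
rewrite meval0 rmorph_prod big1 => [/eqP|j _]; first by rewrite oner_eq0.
by rewrite /= tubular_linE eqxx coord_neq0 mulr0 subr0.
Qed.

(** The indices j found separately for each i assemble into one J, so the union over J becomes a
    condition on each coordinate. *)
Lemma tubular_setE P (v : 'rV[K]_n.+1) : hcoord P v ->
  X P <-> forall i, exists j : 'I_(d i), v 0 (c i) = a j * v 0 ord0.
Proof.
move=> Pv; split=> [[J _ PJ] i|/fin_all_exists[J vJ]].
  exists (J i); apply/eqP; rewrite -subr_eq0 -tubular_linE.
  by apply/eqP; exact: (PJ i v Pv).
exists J => // i; apply/(vanishes_atE (tubular_lin_homogeneous i _) Pv).
by rewrite tubular_linE vJ subrr.
Qed.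

Lemma tubular_gen_eq0 (v : 'I_n.+1 -> K) i :
  (tubular_gen i).@[v] = 0 <-> exists j : 'I_(d i), v (c i) = a j * v ord0.
Proof.
rewrite rmorph_prod /=; split=> [/eqP/prodf_eq0[j _]|[j vj]].
  by rewrite tubular_linE subr_eq0 => /eqP; exists j.
by apply/eqP/prodf_eq0; exists j => //; rewrite tubular_linE vj subrr.
Qed.

Lemma tubular_gen_homogeneous i : homogeneous (tubular_gen i).
Proof. by exists (d i); exact: tubular_gen_homog. Qed.

Lemma tubular_algebraic : algebraic_set X.
Proof.
exists (range tubular_gen); split=> [_ [i _ <-]|]; first exact: tubular_gen_homogeneous.
apply/seteqP; split=> P XP; have [v Pv] := hcoord_ex P.
  move=> _ [i _ <-].
  apply/(vanishes_atE (tubular_gen_homogeneous i) Pv)/tubular_gen_eq0.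
  by have /(tubular_setE Pv) := XP.
apply/(tubular_setE Pv) => i; apply/tubular_gen_eq0.
by apply: (XP (tubular_gen i)) => //; exists i.
Qed.

End Tubular.

Lemma map_tubular_gen (F K : fieldType) (iota : {rmorphism F -> K}) (n r : nat)
    (hrn : (r <= n)%N) (d : 'I_r -> nat) (a : forall i, 'I_(d i) -> F) i :
  map_mpoly iota (tubular_gen hrn a i) = tubular_gen hrn (fun i j => iota (a i j)) i.
Proof.
rewrite rmorph_prod; apply: eq_bigr => j _ /=.
by rewrite rmorphB /= map_mpolyZ !map_mpolyX.
Qed.

Section TubularIdeal.
Variables (K : closedFieldType) (n r : nat) (hrn : (r <= n)%N).
Variables (d : 'I_r -> nat) (a : forall i, 'I_(d i) -> K).
Hypothesis a_inj : forall i, injective (a (i := i)).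
Implicit Types (P : proj K n) (f : {mpoly K[n.+1]}) (v : 'I_n.+1 -> K).

Local Notation c := (Defs.coord hrn).
Local Notation X := (tubular_set hrn a).
Local Notation tubular_lin := (tubular_lin hrn).
Local Notation tubular_gen := (tubular_gen hrn a).

(** Stage s of the induction: only the first s coordinates are constrained, and [in_ideal s] is the
    ideal of the first s generators. *)
Let V s v := v ord0 != 0 /\
  forall i : 'I_r, (i < s)%N -> exists j : 'I_(d i), v (c i) = a j * v ord0.

Let in_ideal s f := exists h : 'I_r -> {mpoly K[n.+1]},
  f = \sum_(i < r | (i < s)%N) h i * tubular_gen i.

Let in_idealD s f g : in_ideal s f -> in_ideal s g -> in_ideal s (f + g).
Proof.
move=> [h ->] [h' ->]; exists (fun i => h i + h' i); rewrite -big_split.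
by apply: eq_bigr => i _; rewrite mulrDl.
Qed.

Let in_idealM s f g : in_ideal s f -> in_ideal s (g * f).
Proof.
move=> [h ->]; exists (fun i => g * h i); rewrite mulr_sumr.
by apply: eq_bigr => i _; rewrite mulrA.
Qed.

(** Induction on the number e of factors. Substituting the e-th value for T_i gives a polynomial
    vanishing on all of [V s], hence in the ideal. The quotient by the linear factor vanishes at the
    earlier values, because the a_ij are distinct and T_0 is nonzero. *)
Let in_ideal_vanishing_step (s : nat) (i : 'I_r) : i = s :> nat ->
    (forall f, (forall v, V s v -> f.@[v] = 0) -> in_ideal s f) ->
  forall e, (e <= d i)%N -> forall f,
    (forall v, V s v -> (exists2 j : 'I_(d i), (j < e)%N & v (c i) = a j * v ord0) ->
       f.@[v] = 0) ->
  exists h, in_ideal s (f - h * \prod_(j < d i | (j < e)%N) tubular_lin i (a j)).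
Proof.
move=> i_s IHs; elim=> [|e IHe] le_e f f0.
  exists f; rewrite big_pred0_eq mulr1 subrr; exists (fun=> 0).
  by rewrite big1 // => k _; rewrite mul0r.
pose j0 := Ordinal le_e; pose L := tubular_lin i (a j0).
pose lq := [tuple if k == c i then a j0 *: 'X_ord0 else 'X_k : {mpoly K[n.+1]}
             | k < n.+1].
have [k|q fq] := @comp_mpoly_congr _ _ lq L _ f.
  rewrite tnth_mktuple; case: eqP => [->|_]; first by exists 1; rewrite mul1r.
  by exists 0; rewrite subrr mul0r.
have rhoE v : (f \mPo lq).@[v] = f.@[fun k => if k == c i then a j0 * v ord0 else v k].
  rewrite comp_mpoly_meval; apply: meval_eq => k; rewrite tnth_mktuple.
  by case: ifP => _; rewrite ?mevalZ mevalXU.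
(* Changing the coordinate [c i] preserves [V s], which constrains only the coordinates of index
   below s = i. *)
have rho0 v : V s v -> (f \mPo lq).@[v] = 0.
  move=> [v0 Vv]; rewrite rhoE; apply: f0.
    split=> [|k ks]; first by rewrite /= ?coord_neq0.
    rewrite /= (inj_eq (@coord_inj _ _ hrn)) ?coord_neq0 -val_eqE /= i_s ltn_eqF //.
    exact: Vv.
  by exists j0; rewrite //= eqxx ?coord_neq0.
have [|h qh] := IHe (ltnW le_e) q.
  move=> v Vv [j je vj].
  have /eqP := congr1 (meval v) fq.
  rewrite mevalM mevalB rho0 // subr0 f0 //; last first.
    by exists j => //; exact: ltnW.
  rewrite eq_sym mulf_eq0 => /orP[/eqP//|].
  rewrite tubular_linE vj -mulrBl mulf_eq0 subr_eq0.
  case: Vv => /negPf-> _; rewrite orbF => /eqP/a_inj ejj.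
  by rewrite ejj ltnn in je.
exists h; rewrite (bigD1 j0) //= (eq_bigl (fun j : 'I_(d i) => (j < e)%N)); last first.
  by move=> j; rewrite ltnS -val_eqE /= ltn_neqAle andbC.
have -> : f - h * (L * \prod_(j < d i | (j < e)%N) tubular_lin i (a j)) =
    (f \mPo lq) + L * (q - h * \prod_(j < d i | (j < e)%N) tubular_lin i (a j)).
  by rewrite mulrBr addrA [L * q]mulrC -fq [_ + (f - _)]addrC subrK mulrCA.
by apply: in_idealD; [exact: IHs|exact: in_idealM].
Qed.

Lemma tubular_ideal f :
  (forall v, v ord0 != 0 ->
     (forall i, exists j : 'I_(d i), v (c i) = a j * v ord0) -> f.@[v] = 0) ->
  ideal_gen tubular_gen f.
Proof.
suff: forall s, (s <= r)%N -> forall f, (forall v, V s v -> f.@[v] = 0) -> in_ideal s f.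
  move=> /(_ r (leqnn r) f) IH f0; have [|h fh] := IH.
    by move=> v [v0 Vv]; apply: f0 => // i; exact: Vv.
  by exists h; rewrite fh; apply: eq_bigl => i; rewrite ltn_ord.
elim=> [|s IHs] lsr {}f f0.
  exists (fun=> 0); rewrite big_pred0_eq; apply/eqP.
  (* With no constraint left, f vanishes wherever T_0 is nonzero, so T_0 f vanishes everywhere. *)
  have /eqP : 'X_ord0 * f = 0.
    apply: meval_eq0 => v; rewrite mevalM mevalXU.
    by have [->|v0] := eqVneq (v ord0) 0; rewrite ?mul0r // f0 ?mulr0.
  by rewrite mulf_eq0 => /orP[/eqP/(congr1 (meval (fun=> 1)))/eqP|//];
    rewrite mevalXU meval0 oner_eq0.
pose i := Ordinal lsr.
have [|h [h' fh]] :=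
  @in_ideal_vanishing_step s i erefl (IHs (ltnW lsr)) (d i) (leqnn _) f.
  move=> v [v0 Vv] [j _ vj]; apply: f0; split=> // k.
  rewrite ltnS leq_eqVlt => /predU1P[ks|/Vv//].
  by have -> : k = i by [exact: val_inj]; exists j.
exists (fun k => if k == i then h else h' k).
rewrite (bigD1 i) //= eqxx (eq_bigl (fun k : 'I_r => (k < s)%N)); last first.
  by move=> k; rewrite ltnS -val_eqE /= ltn_neqAle andbC.
have -> : tubular_gen i = \prod_(j < d i | (j < d i)%N) tubular_lin i (a j).
  by apply: eq_bigl => j; rewrite ltn_ord.
rewrite -[LHS](subrK (h * \prod_(j < d i | (j < d i)%N) tubular_lin i (a j))) addrC fh.
congr (_ + _); apply: eq_bigr => k ks.
by rewrite -val_eqE /= ltn_eqF.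
Qed.

Lemma tubular_vanishing_ideal : vanishing_ideal X = ideal_gen tubular_gen.
Proof.
apply/seteqP; split=> f; last first.
  move=> [h ->] P XP v Pv; rewrite raddf_sum big1 // => i _ /=.
  have [j vj] := (tubular_setE hrn a Pv).1 XP i.
  by rewrite mevalM (tubular_gen_eq0 hrn a _ _).2 ?mulr0 //; exists j.
move=> fX; apply: tubular_ideal => v v0 vj; pose w := \row_k v k.
have w0 : w != 0 by apply/rV0Pn; exists ord0; rewrite mxE.
have [P Pw] := point_ex w0; have -> : f.@[v] = f.@[w 0].
  by apply: meval_eq => k; rewrite mxE.
by apply: (fX P _ w Pw); apply/(tubular_setE hrn a Pw) => i; rewrite !mxE.
Qed.
End TubularIdeal.

(** * Dimension *)

Section Blocks.
Variables r m : nat.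

(** With n written as r + m, the coordinates split into T_0, the r constrained ones and the m free
    ones. *)
Definition lcoord (i : 'I_r) : 'I_(r + m).+1 := lift ord0 (lshift m i).
Definition rcoord (j : 'I_m) : 'I_(r + m).+1 := lift ord0 (rshift r j).

Lemma coord_lcoord (hrn : (r <= r + m)%N) i : Defs.coord hrn i = lcoord i.
Proof. by congr lift; apply: val_inj. Qed.

Variant block_spec : 'I_(r + m).+1 -> Type :=
  | Block0 : block_spec ord0
  | BlockL i : block_spec (lcoord i)
  | BlockR j : block_spec (rcoord j).

Lemma blockP k : block_spec k.
Proof.
case: (unliftP ord0 k) => [k'|] ->; last by constructor.
by case: (split_ordP (k' : 'I_(r + m))) => i ->; constructor.
Qed.

Definition block T (t : T) (b : 'I_r -> T) (y : 'I_m -> T) (k : 'I_(r + m).+1) : T :=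
  if unlift ord0 k is Some k' then
    match fintype.split (k' : 'I_(r + m)) with inl i => b i | inr j => y j end
  else t.

Lemma block0 T t b y : @block T t b y ord0 = t.
Proof. by rewrite /block unlift_none. Qed.

Lemma blockL T t b y i : @block T t b y (lcoord i) = b i.
Proof. by rewrite /block liftK -[lshift m i]/(unsplit (inl i)) unsplitK. Qed.

Lemma blockR T t b y j : @block T t b y (rcoord j) = y j.
Proof. by rewrite /block liftK -[rshift r j]/(unsplit (inr j)) unsplitK. Qed.

Definition blockE := (block0, blockL, blockR).
End Blocks.

Section TubularDimension.
Variables (K : closedFieldType) (r m : nat) (hrn : (r <= r + m)%N).
Implicit Types (P : proj K (r + m)) (b : 'I_r -> K).

Lemma tubular_componentE b P v : hcoord P v ->
  tubular_component hrn b P <-> forall i, v 0 (lcoord m i) = b i * v 0 ord0.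
Proof.
move=> Pv; split=> Pb i; last first.
  apply/(vanishes_atE (tubular_lin_homogeneous hrn i _) Pv).
  by rewrite tubular_linE coord_lcoord Pb subrr.
apply/eqP; rewrite -subr_eq0 -(coord_lcoord hrn) -tubular_linE.
by apply/eqP; exact: Pb Pv.
Qed.

Lemma tubular_component_chain_length b k C :
  irreducible_chain (tubular_component hrn b) k C -> (k <= m)%N.
Proof.
(* The parameters are T_0 and the m free coordinates, whence p = m + 1. *)
pose phi := block (r := r) 'X_ord0 (fun i => b i *: 'X_ord0)
  (fun j => 'X_(lift ord0 j) : {mpoly K[m.+1]}).
apply: (@irreducible_chain_length K _ _ phi) => P v Pb Pv.
exists (fun k => if unlift ord0 k is Some j then v 0 (rcoord r j) else v 0 ord0) => k'.
case: (blockP k') => [|i|j]; rewrite /phi blockE ?mevalZ mevalXU ?unlift_none ?liftK //.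
exact: (tubular_componentE b Pv).1.
Qed.

(** For i <= m this is a linear space of dimension i, since T_0 and the first i free coordinates
    remain arbitrary; [flag b m] is the whole component. *)
Definition flag b (i : nat) : set (proj K (r + m)) :=
  zeros ([set tubular_lin hrn l (b l) | l in setT] `|`
         [set 'X_(rcoord r j) | j in [set j : 'I_m | (i <= j)%N]]).

Lemma flag_forms_homogeneous b i f :
  ([set tubular_lin hrn l (b l) | l in setT] `|`
    [set 'X_(rcoord r j) | j in [set j : 'I_m | (i <= j)%N]]) f ->
  homogeneous f.
Proof.
case=> [[l _ <-]|[j _ <-]]; first exact: tubular_lin_homogeneous.
by exists 1%N; rewrite dhomogX; apply/eqP/mdeg1.
Qed.

Lemma flagE b i P v : hcoord P v ->
  flag b i P <-> (forall l, v 0 (lcoord m l) = b l * v 0 ord0) /\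
                 (forall j : 'I_m, (i <= j)%N -> v 0 (rcoord r j) = 0).
Proof.
move=> Pv; split=> [Pf|[Pl Pr] f Sf].
  split=> [|j ij]; last by rewrite -mevalXU; apply: Pf Pv; right; exists j.
  by apply/(tubular_componentE b Pv) => l; apply: Pf; left; exists l.
apply/(vanishes_atE (flag_forms_homogeneous Sf) Pv).
case: Sf => [[l _ <-]|[j ij <-]]; last by rewrite mevalXU Pr.
by rewrite tubular_linE coord_lcoord Pl subrr.
Qed.

Lemma flag_chain b : irreducible_chain (tubular_component hrn b) m (flag b).
Proof.
(* The first i free coordinates of [pt i] are 1 and the others 0. These points show that each member
   of the flag is nonempty and each inclusion strict. *)
pose pt i : 'rV[K]_(r + m).+1 :=
  \row_k block 1 b (fun j : 'I_m => (j < i)%:R) k.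
have pt_neq0 i : pt i != 0.
  by apply/rV0Pn; exists ord0; rewrite mxE block0 oner_eq0.
have pt_flag i i' P : hcoord P (pt i) -> flag b i' P <-> (minn i m <= i')%N.
  move=> Pi; split=> [/(flagE _ _ Pi)[_ Pr]|ii'].
    rewrite leqNgt; apply/negP; rewrite leq_min => /andP[i'i i'm].
    have /eqP := Pr (Ordinal i'm) (leqnn _).
    by rewrite mxE blockR /= i'i oner_eq0.
  apply/(flagE _ _ Pi); split=> [l|j i'j]; rewrite !mxE !blockE ?mulr1 //.
  have := leq_trans ii' i'j; rewrite geq_min [(m <= j)%N]leqNgt ltn_ord orbF.
  by rewrite ltnNge => ->.
split=> i im.
  split.
  - by eexists; split; last by []; exact: flag_forms_homogeneous.
  - apply: (@irreducible_linear K _ (fun v =>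
      (forall l, v 0 (lcoord m l) = b l * v 0 ord0) /\
      (forall j : 'I_m, (i <= j)%N -> v 0 (rcoord r j) = 0))).
    + move=> v w t [vl vr] [wl wr]; split=> [l|j ij].
        by rewrite !mxE vl wl mulrDr mulrCA.
      by rewrite !mxE vr ?wr // mulr0 addr0.
    + exact: flagE.
    + have [P Pi] := point_ex (pt_neq0 i); exists P.
      by apply/(pt_flag _ _ _ Pi); exact: geq_minl.
  - by move=> P PC l; apply: PC; left; exists l.
split=> [P|/(_ _)sub].
  have [v Pv] := hcoord_ex P => /(flagE _ _ Pv)[vl vr]; apply/(flagE _ _ Pv).
  by split=> // j ij; apply: vr; exact: ltnW.
have [P Pi] := point_ex (pt_neq0 i.+1).
have := (pt_flag _ i _ Pi).1 (sub P ((pt_flag _ i.+1 _ Pi).2 (geq_minl _ _))).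
by rewrite (minn_idPl im) ltnn.
Qed.

(** The flag in one component gives the lower bound. For the upper bound, the top of a chain is
    irreducible, so for each i one factor of the i-th generator vanishes on it; these factors cut
    out a single component containing the chain. *)
Lemma tubular_dim (d : 'I_r -> nat) (a : forall i, 'I_(d i) -> K) :
  (forall i, (0 < d i)%N) -> has_dim (tubular_set hrn a) m.
Proof.
move=> d0; split=> [|k C [irrC ltC]].
  pose J i := Ordinal (d0 i); exists (flag (fun i => a i (J i))).
  have [irrF ltF] := flag_chain (fun i => a i (J i)); split=> // i im.
  by have [? ? sub] := irrF i im; split=> // P /sub; exists J.
have [_ irrCk CkX] := irrC k (leqnn k).
have /fin_all_exists[J CJ] i :
    exists j : 'I_(d i), vanishing_ideal (C k) (tubular_lin hrn i (a i j)).
  apply: (irreducible_prod irrCk (fun j => tubular_lin_homogeneous hrn i (a i j))).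
  move=> P /CkX XP; have [v Pv] := hcoord_ex P.
  apply/(vanishes_atE (tubular_gen_homogeneous hrn a i) Pv)/tubular_gen_eq0.
  exact: ((tubular_setE hrn a Pv).1 XP i).
apply: (@tubular_component_chain_length (fun i => a i (J i)) k C).
have subC e : (e <= k)%N -> C (k - e)%N `<=` C k.
  elim: e => [|e IHe] ek; first by rewrite subn0.
  apply: subset_trans (IHe (ltnW ek)); rewrite -(subnSK ek).
  by have [|] := ltC (k - e.+1)%N; rewrite ?ltn_subrL ?(leq_trans _ ek).
split=> // i ik; have [? ? _] := irrC i ik; split=> // P.
rewrite -(subKn ik) => /(subC _ (leq_subr _ _)) CP l; exact: CJ CP.
Qed.
End TubularDimension.

(** * Degree *)

Lemma card_eq_finType (T : finType) (U : Type) (f : T -> U) (A : set U) :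
  injective f -> (forall x, A x <-> exists t, f t = x) -> (A #= `I_#|T|)%card.
Proof.
move=> f_inj AE; have -> : A = f @` setT.
  apply/seteqP; split=> x; first by case/AE=> t <-; exists t.
  by case=> t _ <-; apply/AE; exists t.
apply: card_eq_trans (inj_card_eq (in2W f_inj)) _.
have -> : `I_#|T| = (fun t : T => enum_rank t : nat) @` setT.
  apply/seteqP; split=> [k kT|_ [t _ <-]]; last exact: ltn_ord.
  by exists (enum_val (Ordinal kT)); rewrite ?enum_valK.
rewrite card_eq_sym; apply: inj_card_eq => s t _ _ /ord_inj; exact: enum_rank_inj.
Qed.

Lemma card_dffun_ord (r : nat) (d : 'I_r -> nat) :
  #|{dffun forall i, 'I_(d i)}| = (\prod_(i < r) d i)%N.
Proof.
rewrite card_dep_ffun foldrE big_map enumT.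
by apply: eq_bigr => i _; rewrite card_ord.
Qed.

Section TubularDegree.
Variables (K : fieldType) (r m : nat) (hrn : (r <= r + m)%N).
Variables (d : 'I_r -> nat) (a : forall i, 'I_(d i) -> K).
Hypothesis a_inj : forall i, injective (a (i := i)).

(** [W] enumerates T_0, ..., T_r among the coordinates, and [left M] is the square block of M in
    these columns. *)
Let W (k : 'I_r.+1) : 'I_(r + m).+1 := lshift m k.
Let left (M : 'M[K]_(r.+1, (r + m).+1)) : 'M[K]_r.+1 := \matrix_(i, j) M i (W j).

Let WS i : W (lift ord0 i) = lcoord m i. Proof. exact: val_inj. Qed.
Let W0 : W ord0 = ord0. Proof. exact: val_inj. Qed.

Let mul_left k (A : 'M_(k, r.+1)) M i j : (A *m M) i (W j) = (A *m left M) i j.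
Proof. by rewrite !mxE; apply: eq_bigr => l _; rewrite !mxE. Qed.

(* All the components meet the hyperplane at infinity in the same subspace, so
   one minor of M decides whether L meets each of them in exactly one point. *)
Lemma tubular_degree :
  almost_all_linear r
    (fun L => (tubular_set hrn a `&` L #= `I_(\prod_(i < r) d i))%card).
Proof.
pose G : {mpoly K[r.+1 * (r + m).+1]} :=
  \det (\matrix_(i < r.+1, j < r.+1) 'X_(mxvec_index i (W j))).
have GE M : G.@[mxvec M 0] = \det (left M).
  rewrite /G -det_map_mx; congr (\det _); apply/matrixP => i j.
  by rewrite mxE mxE /= mevalXU mxvecE mxE.
exists G => [|M freeM].
  (* G is nonzero because it takes the value 1 at a matrix whose left block is the identity. *)
  pose M0 : 'M[K]_(r.+1, (r + m).+1) := \matrix_(i, k) (k == W i)%:R.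
  apply/eqP => /(congr1 (meval (mxvec M0 0)))/eqP; rewrite GE meval0.
  suff -> : left M0 = 1%:M by rewrite det1 oner_eq0.
  by apply/matrixP => i j; rewrite !mxE (inj_eq (@lshift_inj _ _ : injective W)) eq_sym.
rewrite GE -unitfE -unitmxE => unitM.
(* [u J] is the vector of L whose first r + 1 coordinates are 1 and the values a_ij selected by
   J. *)
pose target (J : {dffun forall i, 'I_(d i)}) : 'rV[K]_r.+1 :=
  \row_k if unlift ord0 k is Some i then a (J i) else 1.
pose u J := target J *m invmx (left M) *m M.
have uW J k : u J 0 (W k) = target J 0 k by rewrite mul_left mulmxKV.
have u0 J : u J 0 ord0 = 1 by rewrite -W0 uW mxE unlift_none.
have uL J i : u J 0 (lcoord m i) = a (J i) by rewrite -WS uW mxE liftK.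
have u_neq0 J : u J != 0 by apply/rV0Pn; exists ord0; rewrite u0 oner_eq0.
have [f fu] := choice (fun J => point_ex (u_neq0 J)).
rewrite -card_dffun_ord; apply: (@card_eq_finType _ _ f) => [J J' ff|P].
  have [c _ uc] := hcoord_scale (fu J) (eq_ind_r (fun Q => hcoord Q _) (fu J') ff).
  have c1 : c = 1 by have := u0 J'; rewrite uc mxE u0 mulr1.
  apply/ffunP => i; apply: (@a_inj i).
  by rewrite -!uL uc c1 scale1r.
split=> [[XP LP]|[J <-]]; last first.
  split=> [|v Pv].
    apply/(tubular_setE hrn a (fu J)) => i; exists (J i).
    by rewrite u0 mulr1 coord_lcoord uL.
  have [c _ ->] := hcoord_scale (fu J) Pv.
  by rewrite scalemx_sub // submxMl.
have [v Pv] := hcoord_ex P; have /submxP[w vw] := LP v Pv.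
have [J vJ] := fin_all_exists ((tubular_setE hrn a Pv).1 XP).
(* On X, T_0 = 0 forces T_1 = ... = T_r = 0, and invertibility of the left block then makes the
   vector zero. *)
have v0 : v 0 ord0 != 0.
  apply/eqP => v0; case: Pv => /eqP[]; rewrite vw.
  suff -> : w = 0 by rewrite mul0mx.
  apply: (can_inj (mulmxK unitM)); rewrite mul0mx; apply/rowP => k.
  rewrite -mul_left -vw mxE; case: (unliftP ord0 k) => [i|] ->; last by rewrite W0.
  by rewrite WS -(coord_lcoord hrn) vJ v0 mulr0.
exists [ffun i => J i]; apply: (hcoord_inj (v := u [ffun i => J i])) => //.
suff -> : u [ffun i => J i] = (v 0 ord0)^-1 *: v by apply: hcoordZ; rewrite ?invr_eq0.
rewrite {2}vw scalemxAl; congr (_ *m _); apply: (can_inj (mulmxK unitM)).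
rewrite mulmxKV //; apply/rowP => k.
rewrite -scalemxAl [RHS]mxE -mul_left -vw mxE.
case: (unliftP ord0 k) => [i|] ->; last by rewrite W0 mulVf // unlift_none.
by rewrite WS -(coord_lcoord hrn) vJ mulrC mulfK // ffunE.
Qed.
End TubularDegree.

(** * Rational points *)

Section NormalizedVectors.
Variables (F : finFieldType) (m : nat).
Implicit Types y : {ffun 'I_m -> F}.

(** The first nonzero entry is 1, which selects one representative of each point of the projective
    space of dimension m - 1 over F. *)
Definition normalized y :=
  [exists j, (y j == 1) && [forall k : 'I_m, (k < j)%N ==> (y k == 0)]].

Lemma normalizedP y :
  reflect (exists2 j, y j = 1 & forall k : 'I_m, (k < j)%N -> y k = 0) (normalized y).
Proof.
apply: (iffP existsP) => [[j /andP[/eqP yj /forallP y0]]|[j yj y0]].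
  by exists j => // k kj; apply/eqP/(implyP (y0 k)).
by exists j; rewrite yj eqxx; apply/forallP => k; apply/implyP => /y0 ->.
Qed.

(** Proportional normalized vectors have their leading 1 at the same place; comparing the entries
    there gives c. *)
Lemma normalized_scale_eq1 y y' (c : F) :
  normalized y -> normalized y' -> (forall j, y' j = c * y j) -> c = 1.
Proof.
move=> /normalizedP[j yj y0] /normalizedP[j' yj' y0'] yy'.
case: (ltngtP j j') => [jj'|j'j|/ord_inj jj'].
- have := yy' j; rewrite yj mulr1 y0' // => c0.
  by have := yy' j'; rewrite yj' -c0 mul0r => /eqP; rewrite oner_eq0.
- by have := yy' j'; rewrite yj' y0 // mulr0 => /eqP; rewrite oner_eq0.
- by have := yy' j'; rewrite yj' -jj' yj mulr1.
Qed.

Lemma normalize y j0 : y j0 != 0 ->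
  exists2 c : F, c != 0 & normalized [ffun j => c * y j].
Proof.
move=> yj0; have [j yj minj] := @arg_minnP _ j0 (fun j => y j != 0) val yj0.
exists (y j)^-1; first by rewrite invr_eq0.
apply/normalizedP; exists j => [|k kj]; rewrite ffunE ?mulVf //.
have [->|/minj] := eqVneq (y k) 0; first by rewrite mulr0.
by rewrite /= leqNgt kj.
Qed.

(** Each nonzero vector is uniquely a nonzero scalar times a normalized one, so (q - 1) N = q ^ m -
    1 for the number N sought. *)
Lemma card_normalized :
  #|[set y | normalized y]%SET| = (\sum_(0 <= i < m) #|F| ^ i)%N.
Proof.
have q1 : (1 < #|F|)%N := finNzRing_gt1 F.
pose S := finset.setX [set~ (0 : F)]%SET [set y | normalized y]%SET.
pose scale (u : F * {ffun 'I_m -> F}) := [ffun j => u.1 * u.2 j].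
have scale_inj : {in S &, injective scale}.
  move=> [c y] [c' y']; rewrite !inE /= => /andP[c0 ny] /andP[c'0 ny'] /ffunP eq_cy.
  have eqy j : c * y j = c' * y' j by have := eq_cy j; rewrite !ffunE.
  have : c'^-1 * c = 1.
    by apply: (normalized_scale_eq1 ny ny') => j; rewrite -mulrA eqy mulKf.
  move/(congr1 ( *%R c')); rewrite mulVKf // mulr1 => cc'; rewrite cc' in eqy *.
  by congr (_, _); apply/ffunP => j; apply: (mulfI c'0).
have scaleE : (scale @: S = [set~ [ffun=> 0]])%SET.
  apply/setP => y; rewrite !inE; apply/imsetP/idP => [[[c z]]|y0].
    rewrite !inE /= => /andP[c0 /normalizedP[j zj _]] ->.
    apply/eqP => /ffunP/(_ j)/eqP; rewrite !ffunE zj mulr1; exact/negP.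
  have [j yj] : exists j, y j != 0.
    apply/existsP; apply: contraNT y0 => /existsPn y0; apply/eqP/ffunP => j.
    by rewrite ffunE; apply/eqP/negPn/y0.
  have [c c0 ny] := normalize yj.
  exists (c^-1, [ffun j => c * y j]); first by rewrite !inE invr_eq0 c0.
  by apply/ffunP => k; rewrite !ffunE /= mulKf.
have := card_in_imset scale_inj; rewrite scaleE !cardsC1 cardsX cardsC1.
rewrite card_ffun card_ord predn_exp big_mkord => /eqP.
by rewrite eqn_pmul2l => [/eqP|]; last by rewrite -subn1 subn_gt0.
Qed.
End NormalizedVectors.

Section TubularPoints.
Variables (F : finFieldType) (K : fieldType) (iota : {rmorphism F -> K}).
Variables (r m : nat) (hrn : (r <= r + m)%N).
Variables (d : 'I_r -> nat) (a : forall i, 'I_(d i) -> F).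
Hypothesis a_inj : forall i, injective (a (i := i)).
Hypothesis d_gt0 : forall i, (0 < d i)%N.
Implicit Types (P : proj K (r + m)).

Local Notation X := (tubular_set hrn (fun i j => iota (@a i j))).
Local Notation lift_row w := (map_mx iota w).

(** The scalar is a quotient of two entries in F, so it comes from F. *)
Lemma hcoord_rational_scale P (v w : 'rV[F]_(r + m).+1) :
    hcoord P (lift_row v) -> hcoord P (lift_row w) ->
  exists2 c : F, c != 0 & w = c *: v.
Proof.
move=> Pv Pw; have [c c0 wv] := hcoord_scale Pv Pw.
have /rV0Pn[k vk] : lift_row v != 0 by case: Pv.
have wE j : iota (w 0 j) = c * iota (v 0 j).
  by have := congr1 (fun u : 'rV_ _ => u 0 j) wv; rewrite !mxE.
have cE : c = iota (w 0 k / v 0 k).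
  by rewrite fmorph_div wE mulfK //; move: vk; rewrite mxE.
exists (w 0 k / v 0 k); first by rewrite -(fmorph_eq0 iota) -cE.
by apply/rowP => j; apply: (fmorph_inj iota); rewrite mxE rmorphM -cE wE.
Qed.

Let D := {dffun forall i, 'I_(d i)}.
Let Y := {ffun 'I_m -> F}.

(** Representatives of the rational points: with T_0 = 1, a choice of component and free
    coordinates; at infinity T_0 = ... = T_r = 0 and only the free coordinates remain. *)
Let affine_row (u : D * Y) : 'rV[F]_(r + m).+1 :=
  \row_k block 1 (fun i => a (u.1 i)) u.2 k.
Let infinite_row (y : Y) : 'rV[F]_(r + m).+1 := \row_k block 0 (fun=> 0) y k.

Let affine_row_neq0 u : lift_row (affine_row u) != 0.
Proof. by apply/rV0Pn; exists ord0; rewrite !mxE block0 rmorph1 oner_eq0. Qed.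

Let infinite_row_neq0 y : normalized y -> lift_row (infinite_row y) != 0.
Proof.
case/normalizedP => j yj _; apply/rV0Pn; exists (rcoord r j).
by rewrite !mxE blockR yj rmorph1 oner_eq0.
Qed.

Let affine_inj P u u' :
  hcoord P (lift_row (affine_row u)) -> hcoord P (lift_row (affine_row u')) -> u = u'.
Proof.
case: u u' => [J y] [J' y'] Pu /(hcoord_rational_scale Pu)[c _ /rowP eq_u].
have c1 : c = 1 by have := eq_u ord0; rewrite !mxE !block0 mulr1.
congr (_, _); apply/ffunP => k.
  by apply: (@a_inj k); have := eq_u (lcoord m k); rewrite !mxE !blockL c1 mul1r.
by have := eq_u (rcoord r k); rewrite !mxE !blockR c1 mul1r.
Qed.

Let infinite_inj P y y' : normalized y -> normalized y' ->
  hcoord P (lift_row (infinite_row y)) -> hcoord P (lift_row (infinite_row y')) ->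
  y = y'.
Proof.
move=> ny ny' Py /(hcoord_rational_scale Py)[c _ /rowP eq_y].
have yy' j : y' j = c * y j by have := eq_y (rcoord r j); rewrite !mxE !blockR.
by apply/ffunP => j; rewrite yy' (normalized_scale_eq1 ny ny' yy') mul1r.
Qed.

Let tubularE P w : hcoord P (lift_row w) ->
  X P <-> forall i, exists j : 'I_(d i), w 0 (lcoord m i) = a j * w 0 ord0.
Proof.
move=> Pw; split=> [XP i|Xw].
  have [j] := (tubular_setE hrn (fun i (j : 'I_(d i)) => iota (@a i j)) Pw).1 XP i.
  rewrite !mxE -rmorphM coord_lcoord => /fmorph_inj wj.
  by exists j.
apply: (tubular_setE hrn (fun i (j : 'I_(d i)) => iota (@a i j)) Pw).2 => i.
by have [j wj] := Xw i; exists j; rewrite !mxE -rmorphM coord_lcoord wj.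
Qed.

Let affine_onto P w : hcoord P (lift_row w) -> X P -> w 0 ord0 != 0 ->
  exists u, hcoord P (lift_row (affine_row u)).
Proof.
move=> Pw /(tubularE Pw)/fin_all_exists[J wJ] w0.
exists ([ffun i => J i], [ffun j => (w 0 ord0)^-1 * w 0 (rcoord r j)]).
set u := (_, _).
suff -> : affine_row u = (w 0 ord0)^-1 *: w.
  by rewrite map_mxZ; apply: hcoordZ; rewrite ?fmorph_eq0 ?invr_eq0.
apply/rowP => k; rewrite !mxE; case: (blockP k) => [|i|j]; rewrite blockE /= ?ffunE //.
  by rewrite mulVf.
by rewrite wJ mulrCA mulVf ?mulr1.
Qed.

Let infinite_onto P w : hcoord P (lift_row w) -> X P -> w 0 ord0 = 0 ->
  exists2 y, normalized y & hcoord P (lift_row (infinite_row y)).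
Proof.
move=> Pw /(tubularE Pw) wX w0; pose y : Y := [ffun j => w 0 (rcoord r j)].
have wL i : w 0 (lcoord m i) = 0 by have [j ->] := wX i; rewrite w0 mulr0.
have [j yj] : exists j, y j != 0.
  have /rV0Pn[k] : lift_row w != 0 by case: Pw.
  rewrite mxE fmorph_eq0; case: (blockP k) => [|i|j]; rewrite ?w0 ?wL ?eqxx //.
  by exists j; rewrite ffunE.
have [c c0 ny] := normalize yj; exists [ffun j => c * y j] => //.
suff -> : infinite_row [ffun j => c * y j] = c *: w.
  by rewrite map_mxZ; apply: hcoordZ; rewrite ?fmorph_eq0.
apply/rowP => k; rewrite !mxE.
by case: (blockP k) => [|i|l]; rewrite blockE ?ffunE ?w0 ?wL ?mulr0.
Qed.

Let affine_in P u : hcoord P (lift_row (affine_row u)) -> X P.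
Proof.
move=> Pu; apply/(tubularE Pu) => i; exists (u.1 i).
by rewrite !mxE blockL block0 mulr1.
Qed.

Let infinite_in P y : hcoord P (lift_row (infinite_row y)) -> X P.
Proof.
(* At T_0 = 0 the condition reads 0 = a_ij * 0, so any j will do. *)
move=> Py; apply/(tubularE Py) => i; exists (Ordinal (d_gt0 i)).
by rewrite !mxE blockL block0 mulr0.
Qed.

Let affine_infinite P u y : hcoord P (lift_row (affine_row u)) ->
  hcoord P (lift_row (infinite_row y)) -> False.
Proof.
move=> Pu /(hcoord_rational_scale Pu)[c c0 /rowP/(_ ord0)/eqP].
by rewrite !mxE !block0 mulr1 eq_sym (negPf c0).
Qed.

Let X0_vanishes P w : hcoord P (lift_row w) ->
  vanishes_at 'X_ord0 P <-> w 0 ord0 = 0.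
Proof.
move=> Pw; have hX : homogeneous ('X_ord0 : {mpoly K[(r + m).+1]}).
  by exists 1%N; rewrite dhomogX; apply/eqP/mdeg1.
split=> [/(vanishes_atE hX Pw)|w0]; last first.
  by apply/(vanishes_atE hX Pw); rewrite mevalXU mxE w0 rmorph0.
by rewrite mevalXU mxE => /eqP; rewrite fmorph_eq0 => /eqP.
Qed.

Lemma card_affine_points :
  (rational_points iota (affine_part X) #= `I_(\prod_(i < r) d i * #|F| ^ m))%card.
Proof.
have -> : (\prod_(i < r) d i * #|F| ^ m = #|{: D * Y}|)%N.
  by rewrite card_prod card_dffun_ord card_ffun card_ord.
have [f fu] := choice (fun u => point_ex (affine_row_neq0 u)).
apply: (@card_eq_finType _ _ f) => [u u' ff|P].
  by apply: (affine_inj (fu u)); rewrite ff.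
split=> [[[XP PA] [w Pw]]|[u <-]]; last first.
  split; last by exists (affine_row u).
  split; first exact: affine_in (fu u).
  by move=> /(X0_vanishes (fu u))/eqP; rewrite mxE block0 oner_eq0.
have [|u Pu] := affine_onto Pw XP.
  by apply/eqP => /(X0_vanishes Pw).
by exists u; apply: hcoord_inj (fu u) Pu.
Qed.

Lemma card_projective_points :
  (rational_points iota X #=
     `I_(\prod_(i < r) d i * #|F| ^ m + \sum_(0 <= i < m) #|F| ^ i))%card.
Proof.
pose N := {y : Y | normalized y}.
have -> : (\prod_(i < r) d i * #|F| ^ m + \sum_(0 <= i < m) #|F| ^ i
    = #|{: D * Y + N}|)%N.
  rewrite card_sum card_prod card_dffun_ord card_ffun card_ord -card_normalized.
  by rewrite card_sig cardsE.
pose row (t : D * Y + N) : 'rV[F]_(r + m).+1 :=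
  match t with inl u => affine_row u | inr y => infinite_row (val y) end.
have row_neq0 t : lift_row (row t) != 0.
  by case: t => [u|[y ny]]; [exact: affine_row_neq0|exact: infinite_row_neq0].
have [f ft] := choice (fun t => point_ex (row_neq0 t)).
apply: (@card_eq_finType _ _ f) => [t t' ff|P].
  have Pt := ft t; have Pt' := ft t'; rewrite -ff in Pt'.
  case: t t' {ff} Pt Pt' => [u|[y ny]] [u'|[y' ny']] /= Pt Pt'.
  - by congr inl; exact: affine_inj Pt Pt'.
  - by case: (affine_infinite Pt Pt').
  - by case: (affine_infinite Pt' Pt).
  - by congr inr; apply: val_inj; exact: infinite_inj ny ny' Pt Pt'.
split=> [[XP [w Pw]]|[t <-]]; last first.
  split; last by exists (row t).
  by have := ft t; case: t => [u|y] /=; [exact: affine_in|exact: infinite_in].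
have [w0|w0] := eqVneq (w 0 ord0) 0.
  have [y ny Py] := infinite_onto Pw XP w0.
  pose t : D * Y + N := inr (exist _ y ny); exists t.
  exact: hcoord_inj (ft t) Py.
have [u Pu] := affine_onto Pw XP w0.
by exists (inl u); exact: hcoord_inj (ft (inl u)) Pu.
Qed.
End TubularPoints.

(** * Assembly of the statement *)

(** For m = 0 the convention that [pi_] is 0 at -1 agrees with the empty sum. *)
Lemma pi_sub1 (q m : nat) : pi_ q (m%:Z - 1) = (\sum_(0 <= i < m) q ^ i)%N.
Proof.
case: m => [|m]; first by rewrite big_geq.
by rewrite -addn1 PoszD addrK addn1.
Qed.

Theorem theorem5p1
  (F : finFieldType) (K : closedFieldType) (iota : {rmorphism F -> K})
  (algK : forall x : K, algebraicOver iota x)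
  (n r : nat) (hrn : (r <= n)%N)
  (d : 'I_r -> nat) (hd : forall i, (1 <= d i <= #|F|)%N)
  (a : forall i : 'I_r, 'I_(d i) -> F) (ha : forall i, injective (a i)) :
  let q := #|F| in
  let X : set (proj K n) := tubular_set hrn (fun i j => iota (a i j)) in
  let m := (n - r)%N in
  let deg := (\prod_(i < r) d i)%N in
  [/\ ideal_complete_intersection X,
      defined_over iota X,
      has_dim X m,
      has_multidegree X d
    & has_degree X deg /\ (deg <= q ^ r)%N] /\
  (* (i) *)
  (rational_points iota (affine_part X) #= `I_(deg * q ^ m))%card /\
  (* (ii) *)
  (rational_points iota X #= `I_(deg * q ^ m + pi_ q (m%:Z - 1)))%card /\
  (deg * q ^ m + pi_ q (m%:Z - 1))%N%:Z =
    deg%:Z * (pi_ q m%:Z)%:Z - (deg%:Z - 1) * (pi_ q (m%:Z - 1))%:Z.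
Proof.
move=> q X m deg.
have d_gt0 i : (0 < d i)%N by case/andP: (hd i).
have aK_inj i : injective (fun j => iota (a i j)).
  by move=> j j' /fmorph_inj; exact: ha.
have [k En] : exists k, n = (r + k)%N by exists (n - r)%N; rewrite subnKC.
subst n; have mk : m = k by rewrite /m addKn.
have dimX : has_dim X m by rewrite mk; exact: tubular_dim.
have idealX := tubular_vanishing_ideal hrn aK_inj.
have multX : has_multidegree X d.
  split; [exact: tubular_algebraic|by exists m; rewrite // mk addnC|].
  exists (tubular_gen hrn (fun i j => iota (a i j))); split=> [i|//].
  by split; [exact: tubular_gen_neq0|exact: tubular_gen_homog].
split; [split=> //|split; [|split]].
- by exists r, d.
- exists r, (tubular_gen hrn a); split=> [i|]; first exact: tubular_gen_homogeneous.
  by rewrite idealX; congr ideal_gen; apply/funext => i; rewrite map_tubular_gen.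
- split; first by exists m; rewrite // mk addnK; exact: tubular_degree.
  rewrite -[in leqRHS](card_ord r) -prod_nat_const.
  by apply: leq_prod => i _; case/andP: (hd i).
- by rewrite mk; exact: card_affine_points.
- by rewrite mk pi_sub1; exact: card_projective_points.
(* The two expressions for the number of points agree because pi_m = q ^ m + pi_(m-1). *)
have -> : pi_ q m = (q ^ m + pi_ q (m%:Z - 1))%N.
  by rewrite pi_sub1 /pi_ big_nat_recr //= addnC.
rewrite !PoszD PoszM mulrDr mulrBl mul1r opprB addrA.
by rewrite [_ * _ + _ + _]addrAC addrK.
Qed.
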